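(* Let $H$ be a finite graph and let $G$ be a countable graph satisfying the connected existentially closed (c.e.c.) property. If there is a homomorphism from $G$ to $H$, then there are $2^{\aleph_0}$ distinct distinguishing homomorphisms from $G$ to $H\vee K_2$.
   Context: All graphs are simple, undirected, and countable. A homomorphism $f:G\to H$ is a map $f:V(G)\to V(H)$ such that $xy\in E(G)$ implies $f(x)f(y)\in E(H)$. A homomorphism $f:G\to H$ is distinguishing if the only automorphism $\alpha$ of $G$ satisfying $\alpha(f^{-1}(x))=f^{-1}(x)$ for every $x\in V(H)$ (equivalently $f\circ\alpha=f$) is the identity. A graph $G$ is c.e.c. if for all non-adjacent vertices $u,v$ (which may be equal) and every finite set $T$ of vertices not containing $u$ or $v$, there is a path $P$ of length at least $2$ from $u$ to $v$ (when $u=v$, a closed path through $u$ containing at least one vertex other than $u$) such that no vertex of $P\setminus\{u,v\}$ lies in $T$ or is adjacent to a vertex of $T$. The join $X\vee Y$ of graphs $X,Y$ is obtained from disjoint copies of $X$ and $Y$ by adding all edges between them; $K_2$ is the complete graph on two vertices. $2^{\aleph_0}$ is the cardinality of the continuum. *)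

(* Defs.v *)
From HB Require Import structures.
From mathcomp Require Import all_boot.
From mathcomp Require Import boolp classical_sets functions cardinality.

Set Implicit Arguments.
Unset Strict Implicit.
Unset Printing Implicit Defensive.

Local Open Scope classical_set_scope.

Record graph (V : Type) := Graph {
  adj :> rel V;
  adj_sym : symmetric adj;
  adj_irr : irreflexive adj
}.

Definition homomorphism V W (G : graph V) (H : graph W) (f : V -> W) : Prop :=
  forall x y, G x y -> H (f x) (f y).

Definition automorphism V (G : graph V) (a : V -> V) : Prop :=
  bijective a /\ forall x y, G (a x) (a y) = G x y.

Definition distinguishing V W (G : graph V) (f : V -> W) : Prop :=
  forall a : V -> V, automorphism G a ->
    (forall x : W, a @` (f @^-1` [set x]) = f @^-1` [set x]) ->
    a =1 id.

Definition distinguishing_homs V W (G : graph V) (H : graph W) :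
    set (V -> W) :=
  [set f | homomorphism G H f /\ distinguishing G f].

(* The path P is u, s, v, where s lists the vertices of P other than u and v.
   If u <> v, s <> [::] says that P has length at least 2.  If u = v, it says
   that the closed path P contains a vertex other than u; u, w, u is allowed
   here, which makes the property no stronger than one asking for a cycle
   through u. *)
Definition cec (V : eqType) (G : graph V) : Prop :=
  forall (u v : V) (T : set V),
    ~~ G u v -> finite_set T -> ~ T u -> ~ T v ->
    exists s : seq V,
      [/\ s <> [::], uniq s, u \notin s, v \notin s & path G u (rcons s v)] /\
      (forall x, x \in s -> ~ T x /\ forall t, T t -> ~~ G x t).

Section Join.
Variables (V W : Type) (G : graph V) (H : graph W).

Definition join_adj (x y : V + W) : bool :=
  match x, y with
  | inl a, inl b => G a b
  | inr a, inr b => H a b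
  | _, _ => true
  end.

Lemma join_adj_sym : symmetric join_adj.
Proof. by move=> [x|x] [y|y] //=; exact: adj_sym. Qed.

Lemma join_adj_irr : irreflexive join_adj.
Proof. by move=> [x|x] /=; exact: adj_irr. Qed.

Definition join : graph (V + W) := Graph join_adj_sym join_adj_irr.

End Join.

Section Complete.
Variable n : nat.

Definition complete_adj (i j : 'I_n) : bool := i != j.

Lemma complete_adj_sym : symmetric complete_adj.
Proof. by move=> i j; rewrite /complete_adj eq_sym. Qed.

Lemma complete_adj_irr : irreflexive complete_adj.
Proof. by move=> i; rewrite /complete_adj eqxx. Qed.

Definition complete : graph 'I_n := Graph complete_adj_sym complete_adj_irr.

End Complete.

(* Main.v *)
Require Import Defs.
From mathcomp Require Import all_boot.
From mathcomp Require Import boolp classical_sets functions cardinality.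
From mathcomp Require Import zify.

(** An induced ray [P = g 0, g 1, ...] of [G] can be grown so that any two
    vertices off [P] have distinct neighbourhoods in [P]: to separate [x] from
    [y], the c.e.c. property at [x] gives a neighbour [z] of [x] not adjacent
    to [y] nor to the finite path built so far, and the c.e.c. property between the end
    of that path and [z] prolongs it to [z].  Colour [P] alternately with the
    two vertices of [K_2] and the rest of [G] as before.  An automorphism
    preserving this colouring acts on [P], hence fixes it pointwise (a ray has
    no symmetry), hence fixes every other vertex.  At each stage there are two
    incompatible ways to prolong the path, which gives a continuum of such
    colourings. *)

Set Implicit Arguments.
Unset Strict Implicit.
Unset Printing Implicit Defensive.

Local Open Scope classical_set_scope.
Local Open Scope card_scope.

(** * Finite induced paths and their extension by the c.e.c. property *)

Section InducedPaths.
Variables (V : eqType) (G : graph V).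

Definition avoids (c : seq V) (x : V) : bool :=
  (x \notin c) && all (fun t => ~~ G x t) c.

Fixpoint induced_path (c : seq V) : bool :=
  match c with
  | [::] => true
  | a :: c' =>
    (if c' is b :: c'' then [&& a != b, G a b & avoids c'' a] else true)
    && induced_path c'
  end.

Lemma avoids_cons (b : V) (c : seq V) (x : V) :
  avoids (b :: c) x = [&& x != b, ~~ G x b & avoids c x].
Proof. by rewrite /avoids inE negb_or /= -!andbA; do !bool_congr. Qed.

Lemma induced_path_uniq (c : seq V) : induced_path c -> uniq c.
Proof.
elim: c => //= a [|b c] //= IH /andP[/and3P[ab _ /andP[ac _]] /IH ->].
by rewrite inE negb_or ab ac.
Qed.

Lemma induced_path_adj (x0 : V) (c : seq V) (i j : nat) :
  induced_path c -> (i < size c)%N -> (j < size c)%N ->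
  G (nth x0 c i) (nth x0 c j) = (i == j.+1) || (j == i.+1).
Proof.
have head_adj a d k : induced_path (a :: d) -> (k < size d)%N ->
    G a (nth x0 d k) = (k == 0%N).
  case: d => [|b d] //= /andP[/and3P[_ ab /andP[_ /allP ad]] _].
  by case: k => [//|k] /=; rewrite ltnS => kd; apply/negbTE/ad/mem_nth.
elim: c i j => // a c IH [|i] [|j] ic ia ja.
- by rewrite adj_irr.
- by rewrite [LHS](head_adj a c j).
- by rewrite adj_sym [LHS](head_adj a c i) // orbF.
- by rewrite [LHS]IH //; case/andP: ic.
Qed.

Lemma induced_path_cons2 (a b : V) (c : seq V) :
  induced_path [:: a, b & c] =
  [&& a != b, G a b, avoids c a & induced_path (b :: c)].
Proof. by rewrite /= -!andbA. Qed.

Arguments induced_path _ : simpl never.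

(* Chords from [u] are used as shortcuts, so what is left of the walk is an
   induced path. *)
Lemma induced_path_of_walk (r : seq V) (u : V) (c : seq V) :
  induced_path (u :: c) -> path G u r -> r <> [::] -> uniq (u :: r) ->
  {in r, forall x, avoids c x} ->
  exists e, induced_path (last u r :: e ++ u :: c).
Proof.
have [n] := ubnP (size r); elim: n r u c => // n IH [|w r] // u c.
rewrite ltnS => szr iuc /= /andP[uw wr] _.
rewrite inE negb_or -andbA => /and4P[uNw uNr wNr ur] avr.
have [/hasP[w' w'r uw']|noadj] := boolP (has (G u) r).
  case/splitPr: w'r szr wr uNr wNr ur avr => r1 r2 szr wr uNr wNr ur avr.
  have szr2 : (size (w' :: r2) < n)%N by move: szr; rewrite /= size_cat /=; lia.
  have [||||e] := IH (w' :: r2) u c szr2 iuc.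
  - by move: wr; rewrite cat_path /= uw' => /and3P[].
  - by [].
  - move: uNr ur; rewrite mem_cat negb_or cat_uniq /= => /andP[_ ->].
    by case/and3P.
  - by move=> x xr; apply: avr; rewrite inE mem_cat xr !orbT.
  by rewrite last_cat /= => ie; exists e.
(* With no chord from [u] into [r], all of [r] avoids [u :: c], so the induction goes on with [w] as
   the new head. *)
have iwuc : induced_path (w :: u :: c).
  by rewrite induced_path_cons2 iuc eq_sym uNw adj_sym uw avr ?mem_head.
case: r szr wr uNr wNr ur avr noadj => [|w2 r] szr wr uNr wNr ur avr noadj.
  by exists [::].
have [|||e ie] := IH (w2 :: r) w (u :: c) szr iwuc wr.
- by [].
- by rewrite cons_uniq wNr ur.
- move=> x xr; have avx : avoids c x by apply: avr; rewrite inE xr orbT.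
  rewrite avoids_cons avx andbT; apply/andP; split.
    by apply: contraNneq uNr => <-.
  by rewrite adj_sym; apply: contra noadj => ux; apply/hasP; exists x.
by exists (e ++ [:: w]); rewrite -catA.
Qed.

Hypothesis Gcec : cec G.

(** The vertex [z] is the first one after [x] on a closed path given by the case [u = v = x] of the
    c.e.c. property. *)
Lemma cec_neighbor (x : V) (c : seq V) :
  x \notin c -> exists2 z, G x z & avoids c z.
Proof.
move=> xc; have [||||s [[s0 _ _ _ ps] sT]] := @Gcec x x [set` c].
- by rewrite adj_irr.
- exact: finite_seq.
- exact/negP.
- exact/negP.
case: s s0 ps sT => // z s _ /= /andP[xz _] sT; exists z => //.
have [zc zadj] := sT z (mem_head _ _).
by apply/andP; split; [exact/negP|exact/allP].
Qed.

Lemma cec_reach (u : V) (c : seq V) (z : V) :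
  induced_path (u :: c) -> avoids (u :: c) z ->
  exists e, induced_path (z :: e ++ u :: c).
Proof.
move=> iuc; rewrite avoids_cons => /and3P[zu zNu avz].
(* The forbidden set is [c] without the endpoint [u], so inner vertices may be adjacent to [u];
   [induced_path_of_walk] removes these chords. *)
have [||||s [[s0 us uNs zNs ps] sT]] := @Gcec u z [set` c].
- by rewrite adj_sym.
- exact: finite_seq.
- by have /= /andP[/negP] := induced_path_uniq iuc.
- by case/andP: avz => /negP.
have [|||e] := induced_path_of_walk (r := rcons s z) iuc ps.
- by case: (s).
- by rewrite cons_uniq mem_rcons inE negb_or eq_sym zu uNs rcons_uniq zNs us.
- move=> x; rewrite mem_rcons inE => /predU1P[->//|/sT[xc xadj]].
  by apply/andP; split; [exact/negP|exact/allP].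
by rewrite last_rcons => ie; exists e.
Qed.

(** For [x <> y], each alternative prevents an automorphism fixing [p] from sending [x] to [y]. *)
Definition separated_by (x y p : V) : Prop :=
  [\/ p = x, p = y | G p x <> G p y].

(** One stage of the construction: [e] takes care of the pair [x], [y], and the two values of [d]
    encode one bit of the branch. *)
Lemma extension_step (x y : V) (c : seq V) :
  x <> y -> induced_path c -> c <> [::] ->
  exists (e : seq V) (d : bool -> V),
    [/\ injective d, forall b, induced_path (d b :: e ++ c) &
        exists2 p, p \in e ++ c & separated_by x y p].
Proof.
move=> xy ic c0.
have [e [ie sep]] : exists e, induced_path (e ++ c) /\
    exists2 p, p \in e ++ c & separated_by x y p.
  have [xc|xc] := boolP (x \in c).
    by exists [::]; split=> //; exists x => //; exact: Or31.
  have [yc|yc] := boolP (y \in c).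
    by exists [::]; split=> //; exists y => //; exact: Or32.
  have [|z xz] := @cec_neighbor x (y :: c).
    by rewrite inE negb_or xc andbT; exact/eqP.
  rewrite avoids_cons => /and3P[_ zy avz].
  case: c c0 ic xc yc avz => // u c _ ic xc yc avz.
  have [e ie] := cec_reach ic avz.
  exists (z :: e); split=> //; exists z; first exact: mem_head.
  by apply: Or33; rewrite adj_sym xz (negbTE zy).
have : e ++ c <> [::] by case: (e) c0 => //=.
case E: (e ++ c) ie sep => [//|q l] ie sep _.
have qNl : q \notin l by case/andP: (induced_path_uniq ie).
(* Both branches are neighbours of the head [q] that avoid [l]; the second is also made to avoid
   [d0], hence differs from it. *)
have [d0 qd0 av0] := cec_neighbor qNl.
have qd0N : q != d0 by apply: contraTneq qd0 => ->; rewrite adj_irr.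
have [|d1 qd1] := @cec_neighbor q (d0 :: l); first by rewrite inE negb_or qd0N.
rewrite avoids_cons => /and3P[d10 _ av1].
have qd1N : q != d1 by apply: contraTneq qd1 => ->; rewrite adj_irr.
exists e, (fun b => if b then d1 else d0); rewrite E; split=> //.
- by case=> [] [] // /eqP; [rewrite (negbTE d10)|rewrite eq_sym (negbTE d10)].
- by case; rewrite induced_path_cons2 ie andbT eq_sym adj_sym ?qd0N ?qd1N
    ?qd0 ?qd1 ?av0 ?av1.
Qed.

End InducedPaths.

Arguments induced_path : simpl never.

(** * Induced rays as limits of growing paths *)

Definition induced_ray {V : Type} (G : graph V) (g : nat -> V) : Prop :=
  injective g /\ forall i j, G (g i) (g j) = (i == j.+1) || (j == i.+1).

Section Limit.
Variables (V : eqType) (G : graph V) (v0 : V) (R : nat -> seq V).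
Hypothesis R0 : R 0%N <> [::].
Hypothesis Rpath : forall n, induced_path G (R n).
Hypothesis RS : forall n, exists a e, R n.+1 = a :: e ++ R n.

(* The paths grow at the head, so the ray is read from the end of the lists. *)
Definition limit_ray (k : nat) : V := nth v0 (rev (R k)) k.

Lemma size_growing (n : nat) : (n < size (R n))%N.
Proof.
elim: n => [|n IH]; first by case: (R 0%N) R0.
by have [a [e ->]] := RS n; rewrite /= size_cat; lia.
Qed.

(** Reversed, each path is a prefix of all later ones, so entry [k] is the same in every path long
    enough to have it. *)
Lemma limit_rayE (n k : nat) :
  (k < size (R n))%N -> limit_ray k = nth v0 (rev (R n)) k.
Proof.
have mono m l : exists e, rev (R (m + l)) = rev (R m) ++ e.
  elim: l => [|l [e E]]; first by exists [::]; rewrite addn0 cats0.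
  rewrite addnS; have [a [e' ->]] := RS (m + l).
  by rewrite -cat_cons rev_cat E -catA; eexists.
rewrite /limit_ray => kn; case: (leqP n k) => nk.
  have [e] := mono n (k - n); rewrite subnKC // => ->.
  by rewrite nth_cat size_rev kn.
have [e] := mono k (n - k); rewrite subnKC 1?ltnW // => ->.
by rewrite nth_cat size_rev size_growing.
Qed.

Lemma limit_ray_mem (n : nat) (p : V) :
  p \in R n -> exists2 k, (k < size (R n))%N & limit_ray k = p.
Proof.
move=> pn; exists (index p (rev (R n))).
  by rewrite -size_rev index_mem mem_rev.
by rewrite (@limit_rayE n) ?nth_index ?mem_rev // -size_rev index_mem mem_rev.
Qed.

Lemma limit_ray_induced : induced_ray G limit_ray.
Proof.
have bound i j : (i < size (R (maxn i j)))%N /\ (j < size (R (maxn i j)))%N.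
  by have := size_growing (maxn i j); lia.
split=> [i j|i j]; have [il jl] := bound i j.
  rewrite (limit_rayE il) (limit_rayE jl) => /eqP.
  rewrite nth_uniq ?size_rev // ?rev_uniq; first by move/eqP.
  exact: induced_path_uniq (Rpath _).
rewrite (limit_rayE il) (limit_rayE jl) !nth_rev //.
rewrite (induced_path_adj v0 (Rpath _)); lia.
Qed.

End Limit.

Definition separating {V : eqType} (G : graph V) (g : nat -> V) : Prop :=
  forall x y, x <> y -> exists k, separated_by G x y (g k).

(** Stage [n] treats the pair with code [n], then branches on the bit [b n]. The rays must differ as
    vertex sets, since off the ray the colouring is always the given one. *)
Lemma continuum_of_rays (V : countType) (G : graph V) (v0 : V) :
  cec G ->
  exists g : (nat -> bool) -> nat -> V,
    [/\ forall b, induced_ray G (g b), forall b, separating G (g b) &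
        forall b b', b <> b' -> exists2 w, range (g b) w & ~ range (g b') w].
Proof.
move=> Gcec.
have /choice[F HF] : forall pc : (V * V) * seq V,
    exists ed : seq V * (bool -> V),
    induced_path G pc.2 -> pc.2 <> [::] ->
    [/\ injective ed.2, forall b, induced_path G (ed.2 b :: ed.1 ++ pc.2) &
        pc.1.1 <> pc.1.2 ->
        exists2 p, p \in ed.1 ++ pc.2 & separated_by G pc.1.1 pc.1.2 p].
  move=> [[x y] c] /=.
  have [[ic c0]|nic] := pselect (induced_path G c /\ c <> [::]); last first.
    by exists ([::], fun=> v0) => ic c0; case: nic.
  have [xy|xy] := pselect (x = y); last first.
    have [e [d [dinj ide sep]]] := extension_step Gcec xy ic c0.
    by exists (e, d).
  (* A pair with [x = y] needs no separation, but the path must still grow and branch; any vertex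
     other than [x] serves as partner. *)
  have [z xz _] := cec_neighbor Gcec (isT : x \notin [::]).
  have xNz : x <> z by move=> E; move: xz; rewrite -E adj_irr.
  have [e [d [dinj ide _]]] := extension_step Gcec xNz ic c0.
  by exists (e, d).
(* If [n] codes no pair, the default [(v0, v0)] leaves a stage that only grows and branches. *)
pose st n c := F (odflt (v0, v0) (unpickle n), c).
have stP n c : induced_path G c -> c <> [::] ->
    [/\ injective (st n c).2,
        forall b, induced_path G ((st n c).2 b :: (st n c).1 ++ c) &
        forall x y, x <> y -> unpickle n = Some (x, y) ->
        exists2 p, p \in (st n c).1 ++ c & separated_by G x y p].
  move=> ic c0; have [dinj ide sep] := HF (odflt (v0, v0) (unpickle n), c) ic c0.
  by split=> // x y xy En; move: sep; rewrite /st En; apply.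
pose R b := fix R n := if n is m.+1 then
  (st m (R m)).2 (b m) :: (st m (R m)).1 ++ R m else [:: v0].
have RP b n : induced_path G (R b n) /\ R b n <> [::].
  elim: n => [|n [ic c0]]; first by split.
  by split=> //; have [_ ide _] := stP n _ ic c0; exact: (ide (b n)).
have RE0 b : R b 0%N = [:: v0] by [].
have RES b n : R b n.+1 = (st n (R b n)).2 (b n) :: (st n (R b n)).1 ++ R b n by [].
clearbody R st.
have R0 b : R b 0%N <> [::] by rewrite RE0.
have Rpath b n : induced_path G (R b n) by case: (RP b n).
have RS b n : exists a e, R b n.+1 = a :: e ++ R b n by rewrite RES; do 2!eexists.
exists (fun b => limit_ray v0 (R b)); split=> [b|b x y xy|b b' bb'].
- exact: limit_ray_induced.
- pose n := pickle (x, y); have [ic c0] := RP b n.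
  have [_ _ /(_ x y xy (pickleK _))[p pe sp]] := stP n _ ic c0.
  have pR : p \in R b n.+1 by rewrite RES inE pe orbT.
  by have [k _ kp] := limit_ray_mem v0 (R0 b) (RS b) pR; exists k; rewrite kp.
- have exn : exists n, b n != b' n.
    apply: contrapT => /forallNP bb; apply: bb'; apply/funext => n.
    by apply/eqP/negPn/negP/bb.
  (* Up to the first bit where [b] and [b'] differ, the two paths coincide. *)
  case: (ex_minnP exn) => n bn nmin.
  have RE : R b n = R b' n.
    have : (n <= n)%N by [].
    elim: {-2}n => [|m IH mn]; first by rewrite !RE0.
    rewrite !RES -IH; last exact: ltnW.
    suff -> : b m = b' m by [].
    by apply/eqP/negPn/negP => /nmin; rewrite leqNgt mn.
  have [ic c0] := RP b n.
  have := stP n _ ic c0; case E: (st n _) => [e d] /= [dinj ide _].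
  have RbS : R b n.+1 = d (b n) :: e ++ R b n by rewrite RES E.
  have Rb'S : R b' n.+1 = d (b' n) :: e ++ R b n by rewrite RES -RE E.
  exists (d (b n)).
    have [|k _ <-] := limit_ray_mem v0 (R0 b) (RS b) (n := n.+1) (p := d (b n)).
      by rewrite RbS mem_head.
    by exists k.
  case=> k _ kd.
  have := ide (b n); have := ide (b' n).
  case El: (e ++ R b n) => [|q l]; first by case: (e) c0 El.
  rewrite El in RbS Rb'S => ib' ib.
  have [rinj radj] := limit_ray_induced v0 (R0 b') (Rpath b') (RS b').
  have rayE k' : (k' < (size l).+2)%N -> limit_ray v0 (R b') k' =
      nth v0 (rev [:: d (b' n), q & l]) k'.
    by rewrite -Rb'S => k'l; apply: limit_rayE => //; rewrite Rb'S.
  have gq : limit_ray v0 (R b') (size l) = q.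
    by rewrite rayE // nth_rev //= subSS subSn // subnn.
  have gd : limit_ray v0 (R b') (size l).+1 = d (b' n).
    by rewrite rayE // nth_rev //= subnn.
  (* On the second ray [q] has position [size l]. Its neighbour [d (b n)] could only be the
     predecessor, which lies in [l], or the successor, which is [d (b' n)]; both are excluded. *)
  have := radj (size l) k; rewrite gq kd.
  have -> : G q (d (b n)).
    by rewrite adj_sym; move: ib; rewrite induced_path_cons2 => /and4P[].
  move=> /esym/orP[/eqP lk|/eqP kl].
    have : d (b n) \notin q :: l.
      by have /andP[] := induced_path_uniq ib.
    rewrite -kd rayE; last by lia.
    have -> : rev [:: d (b' n), q & l] = rev (q :: l) ++ [:: d (b' n)].
      by rewrite rev_cons cats1.
    rewrite nth_cat size_rev /= lk ltnS leqW //.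
    by rewrite -mem_rev mem_nth // size_rev /= lk ltnS leqW.
  move: gd; rewrite -kl kd => /dinj.
  by move/eqP: bn.
Qed.

(** * Rigidity of rays and the alternating colouring *)

Lemma induced_ray_rigid (V : Type) (G : graph V) (g : nat -> V) (a : V -> V) :
  induced_ray G g -> automorphism G a ->
  (forall x, range g (a x) <-> range g x) ->
  forall k, a (g k) = g k.
Proof.
move=> [ginj gadj] [abij aadj] arange.
have /choice[s sE] : forall k, exists j, g j = a (g k).
  by move=> k; have [|j _ gj] := (arange (g k)).2; [exists k|exists j].
have sadj i j : ((s i == (s j).+1) || (s j == (s i).+1)) = ((i == j.+1) || (j == i.+1)).
  by rewrite -!gadj !sE aadj.
have sinj i j : s i = s j -> i = j.
  by move=> sij; apply/ginj/(bij_inj abij); rewrite -!sE sij.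
have ssurj m : exists i, s i = m.
  have [h ah ha] := abij.
  have [|i _ gi] := (arange (h (g m))).1; first by rewrite ha; exists m.
  by exists i; apply: ginj; rewrite sE gi ha.
suff sid k : s k = k by move=> k; rewrite -sE sid.
(* The origin is the only vertex of the ray with a single neighbour: otherwise the preimages of [m]
   and [m.+2] would both be [1]. *)
have s0 : s 0%N = 0%N.
  case E: (s 0%N) => [//|m].
  have [i im] := ssurj m; have [j jm] := ssurj m.+2.
  have := sadj i 0%N; have := sadj j 0%N; rewrite E im jm.
  rewrite !eqxx orbT /= !orbF => /esym/eqP j1 /esym/eqP i1.
  by move: im jm; rewrite i1 j1; lia.
elim/ltn_ind: k => -[|[|k]] IH //.
  by have := sadj 1%N 0%N; rewrite s0; lia.
(* The image of [k.+2] is a neighbour of [k.+1] other than [k], which is already taken. *)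
have := sadj k.+2 k.+1; rewrite (IH k.+1) //.
have neq : s k.+2 <> k by rewrite -{2}(IH k) // => /sinj; lia.
by lia.
Qed.

Section RayColoring.
Variables (V W : Type) (f : V -> W) (g : nat -> V).

(** The position of [x] on the ray is obtained by choice; it is unique once [g] is injective. The
    constructor [inr] marks the ray, so the colouring determines [range g]. *)
Definition ray_coloring (x : V) : W + 'I_2 :=
  if pselect (exists k, g k = x) is left kx
  then inr (inord (odd (projT1 (cid kx)))) else inl (f x).

Lemma ray_coloring_off (x : V) :
  ~ range g x -> ray_coloring x = inl (f x).
Proof.
by rewrite /ray_coloring => xg; case: pselect => // -[k kx]; case: xg; exists k.
Qed.

Lemma ray_coloring_on (k : nat) :
  injective g -> ray_coloring (g k) = inr (inord (odd k)).
Proof.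
rewrite /ray_coloring => ginj; case: pselect => [kx|[]]; last by exists k.
by case: cid => j /= /ginj ->.
Qed.

Lemma ray_coloring_range (x y : V) :
  injective g -> ray_coloring x = ray_coloring y -> range g x -> range g y.
Proof.
move=> ginj Exy [k _ kx]; move: Exy; rewrite -kx ray_coloring_on //.
by have [//|yg] := pselect (range g y); rewrite ray_coloring_off.
Qed.

End RayColoring.

(** Edges inside the ray join consecutive positions, of opposite parity; edges leaving it are mapped
    to edges added by the join. *)
Lemma ray_coloring_homomorphism (V W : Type) (G : graph V) (H : graph W)
    (f : V -> W) (g : nat -> V) :
  homomorphism G H f -> induced_ray G g ->
  homomorphism G (join H (complete 2)) (ray_coloring f g).
Proof.
move=> fhom [ginj gadj] x y xy.
have [[i _ xi]|xg] := pselect (range g x); have [[j _ yj]|yg] := pselect (range g y).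
- move: xy; rewrite -xi -yj gadj !ray_coloring_on //= /complete_adj => ij.
  apply/eqP => /(congr1 (@nat_of_ord 2)); rewrite !inordK; lia.
- by rewrite -xi ray_coloring_on // ray_coloring_off.
- by rewrite -yj ray_coloring_on // ray_coloring_off.
- by rewrite !ray_coloring_off //=; exact: fhom.
Qed.

Lemma ray_coloring_distinguishing (V : eqType) (W : Type) (G : graph V)
    (f : V -> W) (g : nat -> V) :
  induced_ray G g -> separating G g ->
  distinguishing G (ray_coloring f g).
Proof.
move=> gray gsep a aaut afib; have [ginj _] := gray.
have aF x : ray_coloring f g (a x) = ray_coloring f g x.
  set F := ray_coloring _ _.
  have : (F @^-1` [set F x]) (a x) by rewrite -afib; exists x.
  by [].
have afix : forall k, a (g k) = g k.
  apply: (induced_ray_rigid gray aaut) => x.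
  by split; apply: ray_coloring_range => //; rewrite aF.
have [abij aadj] := aaut.
(* A moved vertex [x] would be separated from [a x] by some [g k], which [a] fixes. *)
move=> x; apply: contrapT => axx; have [k [gk|gk|]] := gsep _ _ axx.
- by apply: axx; apply: (bij_inj abij); rewrite -gk afix.
- by apply: axx; rewrite -gk afix.
- by rewrite -{1}(afix k) aadj.
Qed.

(** * Counting the colourings *)

Lemma card_le_of_injective (T U : Type) (A : set T) (B : set U) (h : T -> U) :
  {in A &, injective h} -> (forall x, A x -> B (h x)) -> A #<= B.
Proof.
move=> hinj hAB.
have /injfunPex[k] : exists2 f, set_fun A B f & set_inj A f by exists h.
exact: inj_card_le k.
Qed.

Lemma card_fun_le_continuum (V C : countType) (A : set (V -> C)) :
  A #<= [set: nat -> bool].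
Proof.
(* The code of [h] is the characteristic function of its graph, read on the codes of pairs. *)
pose code (h : V -> C) n := if unpickle n is Some (v, c) then h v == c else false.
apply: (card_le_of_injective (h := code)) => // h1 h2 _ _ E.
apply/funext => v; have := congr1 (fun k => k (pickle (v, h1 v))) E.
by rewrite /code pickleK eqxx => /esym/eqP.
Qed.

(** The vertex set must be inhabited: the empty graph is vacuously c.e.c. and has only one
    colouring. *)
Theorem theorem3p1 (W : finType) (H : graph W) (V : countType) (G : graph V) :
  [set: V] !=set0 ->
  cec G ->
  (exists f : V -> W, homomorphism G H f) ->
  distinguishing_homs G (join H (complete 2)) #= [set: nat -> bool].
Proof.
move=> [v0 _] Gcec [f fhom].
have [g [gray gsep gdiff]] := continuum_of_rays v0 Gcec.
rewrite card_eq_le card_fun_le_continuum /=.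
apply: (card_le_of_injective (h := fun b => ray_coloring f (g b))).
  (* A vertex [w] on one ray but not on the other is coloured by [inr] in one case and by [inl] in
     the other. *)
  move=> b b' _ _ E; apply: contrapT => /gdiff[w wb]; apply.
  have [ginj _] := gray b; have [ginj' _] := gray b'.
  move: wb => [k _ kw]; apply: contrapT => wb'.
  have := congr1 (fun F => F w) E.
  by rewrite (ray_coloring_off f wb') -kw ray_coloring_on.
move=> b _; split; first exact: ray_coloring_homomorphism.
exact: ray_coloring_distinguishing.
Qed.
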